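(* Let $G=N\rtimes H$ be a finite Frobenius group with kernel $N$ and complement $H$, where $|N|=q\ge 3$ and $|H|=q-1$, and let $\pi:G\to H$, $\pi(nh)=h$ for $n\in N$, $h\in H$, be the quotient map. Let $\varepsilon\in\{0,1\}$, let $E\subset H\setminus\{1\}$ be an inverse-closed union of conjugacy classes of $H$, and suppose that $S_{\varepsilon,E}=\varepsilon(N\setminus\{1\})\sqcup\pi^{-1}(E)$ is a normal Cayley connection set of $G$. Put $Y=\operatorname{Cay}(H,E)$. Then \[ \operatorname{Cay}(G,S_{0,E})\cong Y[\overline{K_q}],\qquad \operatorname{Cay}(G,S_{1,E})\cong Y[K_q]. \]
   Context: A finite group $G$ is a Frobenius group with kernel $N$ and complement $H$ if $G=N\rtimes H$ is a semidirect product in which $C_N(h)=1$ for every $1\ne h\in H$. The notation $\varepsilon(N\setminus\{1\})$ means the empty set if $\varepsilon=0$ and $N\setminus\{1\}$ if $\varepsilon=1$; so $S_{0,E}=\pi^{-1}(E)$ and $S_{1,E}=(N\setminus\{1\})\sqcup\pi^{-1}(E)$. A normal Cayley connection set of $G$ is an inverse-closed generating set $S\subset G\setminus\{1\}$ that is a union of conjugacy classes of $G$. For a group $\Gamma$ and inverse-closed $S\subset \Gamma\setminus\{1\}$, $\operatorname{Cay}(\Gamma,S)$ is the graph with vertex set $\Gamma$ in which $x,y$ are adjacent iff $x^{-1}y\in S$. For graphs $Y,Z$, the lexicographic product $Y[Z]$ has vertex set $V(Y)\times V(Z)$, with $(y,z)$ adjacent to $(y',z')$ iff $y$ is adjacent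 to $y'$ in $Y$, or $y=y'$ and $z$ is adjacent to $z'$ in $Z$. $K_q$ is the complete graph and $\overline{K_q}$ the edgeless graph on $q$ vertices. *)

(* Defs.v *)
From mathcomp Require Import all_boot all_fingroup all_solvable.
Set Implicit Arguments.
Unset Strict Implicit.
Unset Printing Implicit Defensive.
Import GroupScope.

(* Graphs are bare adjacency relations on a finite vertex type; the graphs     *)
(* built below are simple, as the lemmas ending in _simple show.               *)
Record graph := Graph { vertex : finType; adj : rel vertex }.

Definition simple_graph (Y : graph) : Prop :=
  symmetric (@adj Y) /\ irreflexive (@adj Y).

Definition graph_iso (Y Z : graph) : Prop :=
  exists2 f : vertex Y -> vertex Z,
    bijective f & forall x y, adj (f x) (f y) = adj x y.

Definition complete_graph (q : nat) : graph :=
  @Graph 'I_q (fun i j => i != j).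

Definition edgeless_graph (q : nat) : graph :=
  @Graph 'I_q (fun _ _ => false).

Definition lex_prod (Y Z : graph) : graph :=
  @Graph (vertex Y * vertex Z)%type
    (fun u v => adj u.1 v.1 || (u.1 == v.1) && adj u.2 v.2).

Lemma complete_graph_simple q : simple_graph (complete_graph q).
Proof. by split=> [i j|i] /=; [rewrite eq_sym | rewrite eqxx]. Qed.

Lemma edgeless_graph_simple q : simple_graph (edgeless_graph q).
Proof. by []. Qed.

Lemma lex_prod_simple Y Z :
  simple_graph Y -> simple_graph Z -> simple_graph (lex_prod Y Z).
Proof.
move=> [symY irrY] [symZ irrZ]; split=> [u v|u] /=.
  by rewrite symY symZ eq_sym.
by rewrite irrY irrZ andbF.
Qed.

Section GroupDefs.
Variable gT : finGroupType.
Implicit Types (A : {group gT}) (S E : {set gT}).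

Definition connection_set A S : Prop :=
  S \subset A^# /\ {in S, forall x, x^-1 \in S}.

Definition union_of_classes A S : Prop :=
  exists2 C : {set {set gT}}, C \subset classes A & S = cover C.

Definition normal_connection_set A S : Prop :=
  [/\ connection_set A S, <<S>> = A & union_of_classes A S].

(* The vertex type subg_of A is the subtype of the elements of A.              *)
Definition Cay A S : graph :=
  @Graph (subg_of A) (fun x y => (sgval x)^-1 * sgval y \in S).

Lemma Cay_simple A S : connection_set A S -> simple_graph (Cay A S).
Proof.
case=> /subsetP sSA invS; split=> [x y|x] /=.
  by apply/idP/idP=> /invS; rewrite invMg invgK.
by rewrite mulVg; apply/negP=> /sSA; rewrite !inE eqxx.
Qed.

(* When N ><| H = G, remgr N H is the quotient map pi : G -> H sending n * h   *)
(* to h (remgrMid), so the second term is the preimage of E under pi.          *)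
Definition frob_set (G N H : {group gT}) (eps : bool) E : {set gT} :=
  (if eps then N^# else set0) :|: [set x in G | remgr N H x \in E].

(* The library defines Frobenius groups by a trivial-intersection property of  *)
(* the complement; here this amounts to C_N(h) = 1 for all h in H \ {1}.       *)
Lemma FrobeniusP (G N H : {group gT}) :
    1 < #|N| -> 1 < #|H| ->
  [Frobenius G = N ><| H] <->
    N ><| H = G /\ {in H^#, forall h, 'C_N[h] = 1}.
Proof.
rewrite !cardG_gt1 => ntN ntH; split=> [frobG|[defG regNH]].
  have [defG _ _ _ _] := Frobenius_context frobG.
  by split=> //; apply: Frobenius_reg_ker frobG.
exact/(Frobenius_semiregularP defG ntN ntH).
Qed.

End GroupDefs.

(* Main.v *)
Require Import Defs.
From mathcomp Require Import all_boot all_fingroup all_solvable.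
Import GroupScope.

(* Write x = n h and x' = n' h'. Since pi is a morphism, x^-1 x' lies in     *)
(* pi^-1(E) iff h^-1 h' lies in E, and x^-1 x' lies in N \ {1} iff h = h' and *)
(* n <> n'. Hence x |-> (h, n) is the isomorphism.                            *)

(** The fibres of pi are the cosets of N. Between two distinct fibres the edges are all or none, as
    dictated by [Cay H E]; inside a fibre, the part of the connection set coming from N joins
    nothing or every pair. [mem_frob_set] says this in the coordinates [divgr] and [remgr]. *)

Section SemidirectCayley.

Variables (gT : finGroupType) (G N H : {group gT}).
Hypothesis defG : N ><| H = G.

Lemma remgr_eq1 x : x \in G -> (remgr N H x == 1) = (x \in N).
Proof.
have [_ _ defNH _ _] := sdprod_context defG.
move=> Gx; apply/eqP/idP => [rx1 | Nx]; last exact: remgr1.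
by rewrite (divgr_eq N H x) rx1 mulg1 mem_divgr // defNH.
Qed.

Lemma remgrVM x y : x \in G -> y \in G ->
  remgr N H (x^-1 * y) = (remgr N H x)^-1 * remgr N H y.
Proof.
have [nNG _ _ _ _] := sdprod_context defG.
have rM := remgrM (sdprod_compl defG) nNG.
(* Multiplying by pi(x) leaves only multiplicativity to use, with no separate treatment of
   inverses. *)
move=> Gx Gy; apply: (mulgI (remgr N H x)).
by rewrite -rM ?groupM ?groupV // !mulKVg.
Qed.

Lemma mem_frob_set (eps : bool) (E : {set gT}) x y :
    x \in G -> y \in G ->
  (x^-1 * y \in frob_set G N H eps E) =
    ((remgr N H x)^-1 * remgr N H y \in E)
    || (remgr N H x == remgr N H y)
       && (eps && (divgr N H x != divgr N H y)).
Proof.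
move=> Gx Gy; have Gxy: x^-1 * y \in G by rewrite groupM ?groupV.
rewrite !inE remgrVM // Gxy /= orbC; congr (_ || _).
have -> : (x^-1 * y \in if eps then N^# else set0)
          = eps && (x^-1 * y != 1) && (x^-1 * y \in N).
  by case: eps; rewrite !inE.
rewrite -remgr_eq1 // remgrVM // -!eq_mulVg1 andbC.
case: eqP => //= eq_r; congr (_ && ~~ _).
by rewrite {1}(divgr_eq N H x) {1}(divgr_eq N H y) eq_r (inj_eq (mulIg _)).
Qed.

(** The second factor is convertible to the edgeless or the complete graph once [eps] is a constant,
    so one proof serves both cases. *)
Lemma Cay_frob_set_iso (eps : bool) (E : {set gT}) :
  graph_iso (Cay G (frob_set G N H eps E))
            (lex_prod (Cay H E) (@Graph 'I_#|N| (fun i j => eps && (i != j)))).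
Proof.
have [_ _ defNH _ _] := sdprod_context defG.
pose f (x : subg_of G) : subg_of H * 'I_#|N| :=
  (* Any labelling of N would do; [group1 N] only witnesses that N is nonempty. *)
  (subg H (remgr N H (sgval x)), enum_rank_in (group1 N) (divgr N H (sgval x))).
have rH (x : subg_of G) : remgr N H (sgval x) \in H.
  by rewrite mem_remgr // defNH subgP.
have dN (x : subg_of G) : divgr N H (sgval x) \in N.
  by rewrite mem_divgr // defNH subgP.
have eq1 x y : ((f x).1 == (f y).1)
             = (remgr N H (sgval x) == remgr N H (sgval y)).
  by rewrite -val_eqE /= !subgK.
have eq2 x y : ((f x).2 == (f y).2)
             = (divgr N H (sgval x) == divgr N H (sgval y)).
  by apply/eqP/eqP=> [/enum_rank_in_inj-> //|eq_d]; rewrite /f /= eq_d.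
exists f => [|x y]; last first.
  by rewrite /adj /= mem_frob_set ?subgP // eq1 eq2 !subgK.
(* Injectivity and |G| = |N||H| replace an explicit inverse. *)
apply: inj_card_bij => [x y eq_f|].
  apply: val_inj; rewrite /= (divgr_eq N H (sgval x)) (divgr_eq N H (sgval y)).
  have /eqP := congr1 fst eq_f; rewrite eq1 => /eqP->.
  by have /eqP := congr1 snd eq_f; rewrite eq2 => /eqP->.
by rewrite card_prod card_ord !card_sub -(sdprod_card defG) mulnC.
Qed.

End SemidirectCayley.

Theorem proposition3p4 (gT : finGroupType) (G N H : {group gT}) (q : nat)
    (eps : bool) (E : {set gT})
    (frobG : [Frobenius G = N ><| H])
    (q_ge3 : 3 <= q) (cardN : #|N| = q) (cardH : #|H| = (q - 1)%N)
    (E_conn : connection_set H E) (E_classes : union_of_classes H E)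
    (S_conn : normal_connection_set G (frob_set G N H eps E)) :
  graph_iso (Cay G (frob_set G N H false E))
            (lex_prod (Cay H E) (edgeless_graph q)) /\
  graph_iso (Cay G (frob_set G N H true E))
            (lex_prod (Cay H E) (complete_graph q)).
Proof.
have [defG _ _ _ _] := Frobenius_context frobG.
rewrite -cardN; split.
- exact: (Cay_frob_set_iso _ _ _ _ defG false).
- exact: (Cay_frob_set_iso _ _ _ _ defG true).
Qed.
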